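(* Let $\mathcal{A}=\{A_1,\dots,A_m\}$ be a set of $m$ matrices in $\mathbb{R}^{n\times n}$. Given any positive integer $l$, there exists an explicit path-complete graph $G$ consisting of $m^{l-1}$ nodes, assigned to quadratic Lyapunov functions, and $m^l$ edges with labels of length one, such that the linear matrix inequalities associated with $G$ imply existence of a max-of-quadratics Lyapunov function, and the resulting bound $\hat\rho_{\mathcal{V}^2,G}(\mathcal{A})$ obtained from these linear matrix inequalities satisfies $$\frac{1}{\sqrt[2l]{n}}\,\hat\rho_{\mathcal{V}^2,G}(\mathcal{A})\le\rho(\mathcal{A})\le\hat\rho_{\mathcal{V}^2,G}(\mathcal{A}).$$
   Context: The joint spectral radius is $\rho(\mathcal{A})=\lim_{k\to\infty}\max_{\sigma\in\{1,\dots,m\}^k}\|A_{\sigma_k}\cdots A_{\sigma_1}\|^{1/k}$ (independent of the norm). A finite directed graph $G(N,E)$ (parallel edges and self-loops allowed) whose edges are labeled by single letters from the alphabet $\{A_1,\dots,A_m\}$ is path-complete if for every finite word $A_{\sigma_k}\cdots A_{\sigma_1}$ of any length $k\ge1$ there is a directed path in $G$ whose consecutive edge labels are $A_{\sigma_1},\dots,A_{\sigma_k}$. Assigning quadratic Lyapunov functions $V_v(x)=x^TP_vx$ to the nodes $v\in N$, the linear matrix inequalities associated with $G$, for a scaling $\gamma>0$, are: $P_v\succ0$ for all nodes $v$, and $\gamma^2A_i^TP_vA_i\preceq P_u$ for every edge from node $u$ to node $v$ with label $A_i$. The bound $\hat\rho_{\mathcal{V}^2,G}(\mathcal{A})$ is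 the infimum of $1/\gamma$ over all $\gamma>0$ for which these inequalities are feasible. A max-of-quadratics Lyapunov function for the matrices $\gamma A_1,\dots,\gamma A_m$ is a function $V(x)=\max\{x^TQ_1x,\dots,x^TQ_rx\}$, with each $Q_j\succ0$, which is a common Lyapunov function, i.e. $V(\gamma A_ix)\le V(x)$ for all $x\in\mathbb{R}^n$ and all $i=1,\dots,m$; the assertion that the inequalities imply its existence means that whenever they are feasible for a scaling $\gamma$, such a $V$ exists for that $\gamma$. *)

(* Defs.v *)
From HB Require Import structures.
From mathcomp Require Import all_boot all_order all_algebra.
From mathcomp Require Import all_classical all_reals all_analysis.
Set Implicit Arguments.
Unset Strict Implicit.
Unset Printing Implicit Defensive.
Import Order.TTheory GRing.Theory Num.Theory.
Import numFieldNormedType.Exports.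
Local Open Scope classical_set_scope.
Local Open Scope ring_scope.

(* A word s = [:: i_1; ...; i_k] lists letters in order of application, so
   that word_mx A s = A i_k *m ... *m A i_1. *)
Definition word_mx (R : realType) (m n : nat) (A : 'I_m -> 'M[R]_n)
    (s : seq 'I_m) : 'M[R]_n :=
  foldl (fun M i => A i *m M) 1%:M s.

(* The norm is the entrywise maximum norm of the library; the limit does not
   depend on the norm.  The neutral element 0 of the maximum is harmless, all
   values being nonnegative. *)
Definition jsr (R : realType) (m n : nat) (A : 'I_m -> 'M[R]_n) : R :=
  lim ((fun k : nat =>
    \big[Num.max/0]_(s : k.-tuple 'I_m) `| word_mx A s | `^ (k%:R^-1)) @ \oo).

(* Finite directed multigraph with edges labeled by the letters of the alphabet
   A_0, ..., A_(m-1), a letter being represented by its index.  Edges form a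
   type of their own, so parallel edges and self-loops are allowed. *)
Record lgraph (m : nat) := LGraph {
  node : finType;
  edge : finType;
  source : edge -> node;
  target : edge -> node;
  label : edge -> 'I_m
}.

Definition dipath (m : nat) (G : lgraph m) (p : seq (edge G)) : bool :=
  sorted (fun e f => target e == source f) p.

Definition path_complete (m : nat) (G : lgraph m) : Prop :=
  forall s : seq 'I_m, s != [::] ->
    exists p : seq (edge G), dipath p /\ map (@label m G) p = s.

Definition quad (R : realType) (n : nat) (P : 'M[R]_n) (x : 'cV[R]_n) : R :=
  (x^T *m P *m x) 0 0.

Definition posdefmx (R : realType) (n : nat) (P : 'M[R]_n) : Prop :=
  P^T = P /\ forall x : 'cV[R]_n, x != 0 -> 0 < quad P x.

Definition possemidefmx (R : realType) (n : nat) (P : 'M[R]_n) : Prop :=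
  P^T = P /\ forall x : 'cV[R]_n, 0 <= quad P x.

Definition loewner_le (R : realType) (n : nat) (P Q : 'M[R]_n) : Prop :=
  possemidefmx (Q - P).

Definition lmi (R : realType) (m n : nat) (G : lgraph m) (A : 'I_m -> 'M[R]_n)
    (gamma : R) (P : node G -> 'M[R]_n) : Prop :=
  (forall v, posdefmx (P v)) /\
  (forall e : edge G,
     loewner_le
       (gamma ^+ 2 *: ((A (label e))^T *m P (target e) *m A (label e)))
       (P (source e))).

Definition lmi_feasible (R : realType) (m n : nat) (G : lgraph m)
    (A : 'I_m -> 'M[R]_n) (gamma : R) : Prop :=
  exists P : node G -> 'M[R]_n, lmi A gamma P.

(* The set below is nonempty (take P v = 1%:M and gamma small) and bounded
   below by 0, so inf is the true infimum. *)
Definition rho_hat (R : realType) (m n : nat) (G : lgraph m)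
    (A : 'I_m -> 'M[R]_n) : R :=
  inf [set gamma^-1 | gamma in [set g : R | 0 < g /\ lmi_feasible G A g]].

(* Maximum of a nonempty family of quadratic forms. *)
Definition max_quad (R : realType) (n r : nat) (Q : 'I_r.+1 -> 'M[R]_n)
    (x : 'cV[R]_n) : R :=
  \big[Num.max/quad (Q ord0) x]_(j < r.+1) quad (Q j) x.

Definition has_max_quad_lyapunov (R : realType) (m n : nat)
    (B : 'I_m -> 'M[R]_n) : Prop :=
  exists (r : nat) (Q : 'I_r.+1 -> 'M[R]_n),
    (forall j, posdefmx (Q j)) /\
    (forall (i : 'I_m) (x : 'cV[R]_n), max_quad Q (B i *m x) <= max_quad Q x).

(* Main.v *)
Require Import Defs.
From HB Require Import structures.
From mathcomp Require Import all_boot all_order all_algebra.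
From mathcomp Require Import fingroup perm.
From mathcomp Require Import all_classical all_reals all_analysis.
From mathcomp Require Import ring lra.
Import Order.TTheory GRing.Theory Num.Theory.
Import numFieldNormedType.Exports.
Local Open Scope ring_scope.

(** The joint spectral radius is the infimum of the rates [r] such that all
    products of length [k] are bounded by a multiple of [r ^+ k] ([jsrE]).

    The graph is the De Bruijn graph whose nodes are the words of length
    [l - 1].  Each node is entered by an edge of every letter, whence
    path-completeness ([fully_entered_path_complete]); for the same reason, the
    maximum of the forms attached to the nodes is a common Lyapunov function of
    the scaled matrices ([lmi_max_quad_lyapunov]).  Such a function bounds the
    growth of products, so [jsr A <= rho_hat G A] ([jsr_le_of_lyapunov]).

    For the other inequality, let [r > jsr A].  All products of the matrices
    [r^-1 *: A i] are bounded, and the supremum of the norms of the images of [x]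
    under them is a norm which none of the matrices increases.  By the theorem
    of Loewner and John, its square is a quadratic form [P] up to a factor [n],
    here replaced by any [c > n] ([approx_lowner_ellipsoid]).  Hence every product,
    of length [l] in particular, increases [P] by a factor at most [c], and
    rescaling each letter by [c ^ (-1 / 2l)] makes all products of length [l]
    contractions for [P] ([common_quadratic_of_growth]).  Summing [P] along the
    [l - 1] letters announced by a node then solves the linear matrix
    inequalities of the De Bruijn graph ([contraction_lmi_feasible]).  The bound
    follows by letting [c] tend to [n] and [r] to [jsr A]. *)

(** * Quadratic forms *)

Lemma quadDl {R : realType} {n : nat} (P Q : 'M[R]_n) (x : 'cV[R]_n) :
  quad (P + Q) x = quad P x + quad Q x.
Proof. by rewrite /quad mulmxDr mulmxDl mxE. Qed.

Lemma quadZl {R : realType} {n : nat} (a : R) (P : 'M[R]_n) (x : 'cV[R]_n) :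
  quad (a *: P) x = a * quad P x.
Proof. by rewrite /quad -scalemxAr -scalemxAl mxE. Qed.

Lemma quad_suml {R : realType} {n : nat} (I : Type) (r : seq I)
    (P : I -> 'M[R]_n) (x : 'cV[R]_n) :
  quad (\sum_(i <- r) P i) x = \sum_(i <- r) quad (P i) x.
Proof.
elim/big_rec2: _ => [|i y P' _ <-]; last by rewrite quadDl.
by rewrite /quad mulmx0 mul0mx mxE.
Qed.

Lemma quad_congr {R : realType} {n p : nat} (B : 'M[R]_(p, n)) (P : 'M[R]_p)
    (x : 'cV[R]_n) :
  quad (B^T *m P *m B) x = quad P (B *m x).
Proof. by rewrite /quad trmx_mul !mulmxA. Qed.

Lemma quad_rank1 {R : realType} {n : nat} (f : 'rV[R]_n) (x : 'cV[R]_n) :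
  quad (f^T *m f) x = (f *m x) 0 0 ^+ 2.
Proof.
rewrite /quad mulmxA -mulmxA -trmx_mul mxE big_ord_recl big_ord0 addr0.
by rewrite !mxE expr2.
Qed.

Lemma quad0 {R : realType} {n : nat} (P : 'M[R]_n) : quad P 0 = 0.
Proof. by rewrite /quad mulmx0 mxE. Qed.

Lemma quad_scale {R : realType} {n : nat} (P : 'M[R]_n) (a : R) (x : 'cV[R]_n) :
  quad P (a *: x) = a ^+ 2 * quad P x.
Proof.
have -> : quad P (a *: x) = ((a *: x^T) *m P *m (a *: x)) 0 0.
  by rewrite /quad [X in X *m P]linearZ.
by rewrite -!scalemxAl -scalemxAr scalerA mxE expr2.
Qed.

Lemma quad_congr_scale {R : realType} {n : nat} (a : R) (A P : 'M[R]_n)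
    (x : 'cV[R]_n) :
  quad (a ^+ 2 *: (A^T *m P *m A)) x = quad P ((a *: A) *m x).
Proof. by rewrite quadZl quad_congr -scalemxAl quad_scale. Qed.

Lemma delta_form {R : realType} {n : nat} (P : 'M[R]_n) (i j : 'I_n) :
  ((delta_mx i 0 : 'cV[R]_n)^T *m P *m (delta_mx j 0 : 'cV[R]_n)) 0 0 = P i j.
Proof. by rewrite trmx_delta -rowE -colE !mxE. Qed.

Lemma quad_polarize {R : realType} {n : nat} (P : 'M[R]_n) (a : R)
    (x y : 'cV[R]_n) : P^T = P ->
  quad P (x + a *: y) =
    quad P x + a * (x^T *m P *m y) 0 0 *+ 2 + a ^+ 2 * quad P y.
Proof.
move=> sP; rewrite /quad.
have -> : (x + a *: y)^T = x^T + a *: y^T by rewrite linearD linearZ.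
rewrite !mulmxDl !mulmxDr -!scalemxAl -!scalemxAr.
have -> : y^T *m P *m x = (x^T *m P *m y)^T.
  by rewrite !trmx_mul trmxK sP mulmxA.
rewrite scalerA.
have E (M N : 'M[R]_1) : (M + N) 0 0 = M 0 0 + N 0 0 by rewrite mxE.
have E' (b : R) (M : 'M[R]_1) : (b *: M) 0 0 = b * M 0 0 by rewrite mxE.
have E'' (M : 'M[R]_1) : M^T 0 0 = M 0 0 by rewrite mxE.
by rewrite !(E, E', E''); ring.
Qed.

Lemma posdef_quad_ge0 {R : realType} {n : nat} {P : 'M[R]_n} (x : 'cV[R]_n) :
  posdefmx P -> 0 <= quad P x.
Proof.
case=> _ pP; have [->|/pP/ltW//] := eqVneq x 0; by rewrite quad0.
Qed.

Lemma posdef_unitmx {R : realType} {n : nat} {P : 'M[R]_n} :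
  posdefmx P -> P \in unitmx.
Proof.
case=> sP pP; rewrite unitmxE unitfE; apply/det0P => -[v v0 vP].
have /pP : v^T != 0.
  by apply: contra v0 => /eqP/(congr1 trmx); rewrite trmxK trmx0 => ->.
by rewrite /quad trmxK vP mul0mx mxE ltxx.
Qed.

(** Expanding [0 <= quad P (x - a *: z)] with [z = invmx P *m f^T] gives the
    Cauchy-Schwarz inequality between [P] and its dual form.  The multiplier [a]
    involves [c] rather than the dual norm of [f], which may vanish. *)
Lemma posdef_dual_bound {R : realType} {n : nat} {P : 'M[R]_n}
    {f : 'rV[R]_n} {c : R} (x : 'cV[R]_n) :
  posdefmx P -> 0 < c -> (f *m invmx P *m f^T) 0 0 <= c ->
  (f *m x) 0 0 ^+ 2 <= c * quad P x.
Proof.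
move=> pdP c0 qc; have [sP _] := pdP.
set z := invmx P *m f^T; set u := (f *m x) 0 0.
have Pz : P *m z = f^T by rewrite mulmxA mulmxV ?mul1mx// posdef_unitmx.
have exz : (x^T *m P *m z) 0 0 = u by rewrite -mulmxA Pz -trmx_mul mxE.
have ezz : quad P z = (f *m invmx P *m f^T) 0 0.
  by rewrite /quad -mulmxA Pz -trmx_mul mxE /z mulmxA.
have := posdef_quad_ge0 (x + (- (u / c)) *: z) pdP.
rewrite quad_polarize // exz ezz => h.
have h1 : 0 <= quad P x + - (u / c) * u *+ 2 + (- (u / c)) ^+ 2 * c.
  by apply: le_trans h _; rewrite lerD2l ler_wpM2l// sqr_ge0.
have e : quad P x + - (u / c) * u *+ 2 + (- (u / c)) ^+ 2 * c =
   quad P x - u ^+ 2 / c by field; rewrite gt_eqF.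
by rewrite e subr_ge0 ler_pdivrMr// mulrC in h1.
Qed.

(** The dual bound on coordinate functionals compares a positive definite form
    with the maximum norm; it replaces a compactness argument on the sphere. *)
Lemma posdef_coercive {R : realType} {n : nat} (P : 'M[R]_n) : posdefmx P ->
  exists2 c : R, 0 < c & forall (x : 'cV[R]_n) i, x i 0 ^+ 2 <= c * quad P x.
Proof.
move=> pdP; pose c := \sum_i `|invmx P i i| + 1.
have c0 : 0 < c by rewrite ltr_wpDl// sumr_ge0.
exists c => // x i.
have -> : x i 0 = ((delta_mx 0 i : 'rV[R]_n) *m x) 0 0 by rewrite -rowE mxE.
apply: posdef_dual_bound => //.
have e : delta_mx 0 i = (delta_mx i 0 : 'cV[R]_n)^T by rewrite trmx_delta.
rewrite e trmxK delta_form.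
apply: le_trans (ler_norm _) _.
by rewrite /c (bigD1 i)//= -addrA lerDl addr_ge0// sumr_ge0.
Qed.

(** * Rank-one updates and the Loewner ellipsoid *)

(** Matrix determinant lemma.  The upper right block of [N] can be cleared by row
    operations, leaving the updated matrix on the diagonal, or by column
    operations, leaving [P] and the scalar factor; both preserve the
    determinant. *)
Lemma det_rank1_update {R : realType} {n : nat} (P : 'M[R]_n) (a : R)
    (f : 'rV[R]_n) : P \in unitmx ->
  \det (P + a *: (f^T *m f)) = \det P * (1 + a * (f *m invmx P *m f^T) 0 0).
Proof.
move=> uP.
pose N : 'M[R]_(n + 1) := block_mx P (- (a *: f^T)) f 1%:M.
have e1 : block_mx 1%:M (a *: f^T) 0 1%:M *m N =
          block_mx (P + a *: (f^T *m f)) 0 f 1%:M.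
  rewrite mulmx_block !mul1mx !mul0mx !mulmx1 !add0r -scalemxAl.
  by rewrite addNr.
have e2 : N *m block_mx 1%:M (a *: (invmx P *m f^T)) 0 1%:M =
          block_mx P 0 f (1%:M + a *: (f *m invmx P *m f^T)).
  rewrite mulmx_block !mulmx1 !mulmx0 !addr0 -!scalemxAr !mulmxA mulmxV//.
  by rewrite mul1mx addrN addrC.
have := congr1 determinant e1; have := congr1 determinant e2.
rewrite !det_mulmx !det_ublock !det_lblock !det1 !mulr1 !mul1r => -> <-.
by rewrite det_mx11 !mxE eqxx.
Qed.

(** Off the diagonal, the bound comes from positivity of the form at the sum
    and at the difference of two basis vectors. *)
Lemma posdef_entry_le {R : realType} {n : nat} {P : 'M[R]_n} {b : R} :
  posdefmx P -> (forall i, P i i <= b) -> forall i j, `|P i j| <= b.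
Proof.
move=> pdP dP i j; have [sP _] := pdP.
have h a := posdef_quad_ge0 (delta_mx i 0 + a *: delta_mx j 0) pdP.
have := h 1; have := h (-1).
rewrite !quad_polarize // /quad !delta_form => h1 h2.
have := dP i; have := dP j; rewrite ler_norml => ? ?.
by apply/andP; split; lra.
Qed.

Lemma det_entry_bound {R : realType} {n : nat} (P : 'M[R]_n) (b : R) :
  (forall i j, `|P i j| <= b) -> \det P <= b ^+ n *+ n`!.
Proof.
move=> hP; rewrite /determinant.
apply: le_trans (ler_norm _) _; apply: le_trans (ler_norm_sum _ _ _) _.
rewrite -card_Sn -sumr_const; apply: ler_sum => s _.
rewrite normrM normrX normrN1 expr1n mul1r normr_prod.
rewrite -[n in X in _ <= X](card_ord n) -prodr_const.
by apply: ler_prod => i _; rewrite normr_ge0 hP.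
Qed.

Lemma bernoulli_ineq {R : realType} (t : R) (k : nat) :
  0 <= t <= 1 -> 1 - k%:R * t <= (1 - t) ^+ k.
Proof.
move=> /andP[t0 t1]; elim: k => [|k IH]; first by rewrite mul0r subr0 expr0.
rewrite exprS; apply: (@le_trans _ _ ((1 - t) * (1 - k%:R * t))); last first.
  by rewrite ler_wpM2l // subr_ge0.
rewrite -natr1; have : 0 <= k%:R :> R by []. nra.
Qed.

(** Approximate form of the theorem of Loewner and John.  The unit ball of the
    seminorm [sup_(f in F) |f x|] is given by its functionals, so no separation
    theorem is needed.  Among the positive definite forms dominated by the
    square of this seminorm, whose determinants are bounded, choose [P] with
    nearly maximal determinant.  If some [f] in [F] had dual square norm [q]
    larger than [c > n] with respect to [P], then moving from [P] towards
    [f^T *m f] by the amount [t] would keep the form dominated and multiply the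
    determinant by [(1 - t) ^+ (n - 1) * (1 - t + t * q)], which is
    about [1 + t * (q - n)]: too large.  Near-maximality suffices, at the
    price of [c > n] in place of [n], and avoids compactness. *)
Lemma approx_lowner_ellipsoid {R : realType} {n : nat}
    (F : set 'rV[R]_n) (b : R) (c : R) :
  (0 < n)%N -> (forall f i, F f -> `|f 0 i| <= b) ->
  (forall i, F (delta_mx 0 i)) -> n%:R < c ->
  exists2 P : 'M[R]_n, posdefmx P &
    (forall x d, (forall f, F f -> (f *m x) 0 0 ^+ 2 <= d) -> quad P x <= d) /\
    (forall f x, F f -> (f *m x) 0 0 ^+ 2 <= c * quad P x).
Proof.
case: n F => // n F _ Fb Fe nc.
pose adm (P : 'M[R]_n.+1) := posdefmx P /\ forall x d,
  (forall f, F f -> (f *m x) 0 0 ^+ 2 <= d) -> quad P x <= d.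
have n1_gt0 : 0 < n.+1%:R :> R by rewrite ltr0n.
have c_gt0 : 0 < c := lt_trans n1_gt0 nc.
(* The mean of the squares of the coordinate functionals. *)
pose P0 : 'M[R]_n.+1 := n.+1%:R^-1%:M.
have qP0 x : quad P0 x = n.+1%:R^-1 * \sum_i x i 0 ^+ 2.
  rewrite /quad /P0 mul_mx_scalar -scalemxAl mxE; congr (_ * _).
  by rewrite mxE; apply: eq_bigr => i _; rewrite mxE expr2.
have admP0 : adm P0.
  split; first split.
  - by rewrite /P0 tr_scalar_mx.
  - move=> x x0; rewrite qP0 mulr_gt0 ?invr_gt0// lt_neqAle eq_sym.
    rewrite sumr_ge0 ?andbT => [|i _]; last exact: sqr_ge0.
    apply: contra x0; rewrite psumr_eq0 => [/allP xe|i _]; last exact: sqr_ge0.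
    apply/eqP/matrixP => i j; rewrite (ord1 j) mxE.
    by have /= := xe i (mem_index_enum i); rewrite sqrf_eq0 => /eqP.
  - move=> x d xd; rewrite qP0 mulrC ler_pdivrMr// mulr_natr.
    rewrite -[n.+1 in X in _ <= X]card_ord -sumr_const; apply: ler_sum => i _.
    by have := xd _ (Fe i); rewrite -rowE mxE.
pose S := [set \det P | P in adm]%classic.
have S0 : (S !=set0)%classic by exists (\det P0), P0.
have S_ub : has_ubound S.
  exists ((b ^+ 2) ^+ n.+1 *+ n.+1`!) => _ [P [pdP domP] <-].
  apply: det_entry_bound; apply: posdef_entry_le => // i.
  rewrite -delta_form; apply: domP => f Ff.
  rewrite -colE mxE -(real_normK (num_real _)).
  by rewrite lerXn2r ?nnegrE// ?Fb// (le_trans _ (Fb _ i Ff)).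
have sup_gt0 : 0 < sup S.
  apply: (@lt_le_trans _ _ (\det P0)); last by apply: ub_le_sup => //; exists P0.
  by rewrite det_scalar exprn_gt0 // invr_gt0.
(* To first order the determinant grows by [t * (c - n.+1%:R)]; the step is small
   enough for this gain to exceed the error terms, of order [t ^+ 2]. *)
pose t := (c - n.+1%:R) / (n.+1%:R * c).
have n_ge0 : 0 <= n%:R :> R by [].
have nS : n.+1%:R = n%:R + 1 :> R by rewrite natr1.
have D_gt0 : 0 < n.+1%:R * c by rewrite mulr_gt0.
have tE : t * (n.+1%:R * c) = c - n.+1%:R by rewrite /t divfK // gt_eqF.
have t_gt0 : 0 < t by rewrite divr_gt0 // subr_gt0.
have t_lt1 : t < 1.
  by rewrite /t ltr_pdivrMr // mul1r nS; rewrite nS in nc; nra.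
have nt_le1 : n%:R * t <= 1.
  rewrite /t mulrA ler_pdivrMr // mul1r nS; rewrite nS in nc; nra.
have t2_gt0 : 0 < 1 + t ^+ 2 by rewrite ltr_pwDl // sqr_ge0.
have [_ [P admP <-] detP] : exists2 y, S y & sup S / (1 + t ^+ 2) < y.
  apply: sup_gt => //; rewrite ltr_pdivrMr // ltr_pMr //.
  by rewrite ltrDl exprn_gt0.
have [pdP domP] := admP; have [sP pP] := pdP.
exists P => //; split => // f x Ff.
apply: posdef_dual_bound => //; rewrite leNgt; apply/negP.
set q := (_ *m f^T) 0 0 => qc.
pose Q := (1 - t) *: P + t *: (f^T *m f).
have quadQ y : quad Q y = (1 - t) * quad P y + t * (f *m y) 0 0 ^+ 2.
  by rewrite quadDl !quadZl quad_rank1.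
have admQ : adm Q.
  split; first split.
  - by rewrite /Q linearD !linearZ /= sP trmx_mul trmxK.
  - move=> y y0; rewrite quadQ ltr_pwDl ?mulr_gt0 ?pP ?subr_gt0//.
    by rewrite mulr_ge0 ?sqr_ge0// ltW.
  - move=> y d yd; rewrite quadQ.
    have := domP y d yd; have := yd f Ff; nra.
have detQ : \det Q = (1 - t) ^+ n * (1 - t + t * q) * \det P.
  have t1 : 1 - t != 0 by rewrite subr_eq0 gt_eqF.
  have -> : Q = (1 - t) *: (P + (t / (1 - t)) *: (f^T *m f)).
    by rewrite scalerDr scalerA mulrCA mulfV ?mulr1.
  rewrite detZ det_rank1_update ?posdef_unitmx// -/q exprSr.
  by field.
have : \det Q <= sup S by apply: ub_le_sup => //; exists Q.
have dP0 : 0 < \det P by apply: lt_trans detP; rewrite divr_gt0.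
rewrite detQ leNgt => /negP; apply.
rewrite ltr_pdivrMr // mulrC in detP; apply: lt_le_trans detP _.
rewrite ler_pM2r //.
apply: (@le_trans _ _ ((1 - n%:R * t) * (1 - t + t * c))); last first.
  apply: ler_pM; [by rewrite subr_ge0| |by apply: bernoulli_ineq; rewrite !ltW|].
    by nra.
  by nra.
have -> : (1 - n%:R * t) * (1 - t + t * c) =
   1 + t * ((c - n.+1%:R) - t * n%:R * (c - 1)) by rewrite nS; ring.
rewrite lerD2l expr2 ler_pM2l // -tE nS.
rewrite nS in nc; nra.
Qed.

(** * Growth of matrix products and the joint spectral radius *)

Lemma mx_entry_le_norm {R : realType} {m n : nat} (A : 'M[R]_(m, n)) i j :
  `|A i j| <= `|A|.
Proof.
rewrite [X in _ <= X]mx_normrE.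
exact: (le_bigmax _ (fun ij => `|A ij.1 ij.2|) (i, j)).
Qed.

Lemma mx_norm_le {R : realType} {m n : nat} (A : 'M[R]_(m, n)) b :
  0 <= b -> (forall i j, `|A i j| <= b) -> `|A| <= b.
Proof.
by move=> b0 Ab; rewrite [X in X <= _]mx_normrE; apply: bigmax_le => // -[].
Qed.

Lemma mx_norm_mul {R : realType} {m n p : nat} (A : 'M[R]_(m, n))
    (B : 'M[R]_(n, p)) : `|A *m B| <= n%:R * `|A| * `|B|.
Proof.
apply: mx_norm_le => [|i j]; first by rewrite !mulr_ge0.
rewrite mxE; apply: le_trans (ler_norm_sum _ _ _) _.
have -> : n%:R * `|A| * `|B| = \sum_(k < n) `|A| * `|B|.
  by rewrite sumr_const card_ord -mulrA mulr_natl.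
by apply: ler_sum => k _; rewrite normrM ler_pM ?mx_entry_le_norm.
Qed.

Lemma word_mx_cat {R : realType} {m n : nat} (A : 'I_m -> 'M[R]_n)
    (s t : seq 'I_m) :
  word_mx A (s ++ t) = word_mx A t *m word_mx A s.
Proof.
rewrite /word_mx foldl_cat; elim/last_ind: t => [|t i IH]; first by rewrite mul1mx.
by rewrite -cats1 !foldl_cat /= IH mulmxA.
Qed.

Lemma word_mx_cons {R : realType} {m n : nat} (A : 'I_m -> 'M[R]_n) i
    (s : seq 'I_m) :
  word_mx A (i :: s) = word_mx A s *m A i.
Proof. by rewrite -cat1s word_mx_cat {2}/word_mx /= mulmx1. Qed.

Lemma word_mxZ {R : realType} {m n : nat} (a : R) (A : 'I_m -> 'M[R]_n)
    (s : seq 'I_m) :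
  word_mx (fun i => a *: A i) s = a ^+ size s *: word_mx A s.
Proof.
elim: s => [|i s IH]; first by rewrite scale1r.
by rewrite !word_mx_cons IH -scalemxAl -scalemxAr scalerA -exprSr.
Qed.

Definition growth_bound {R : realType} {m n : nat} (A : 'I_m -> 'M[R]_n) (r : R) :=
  exists K : R, forall s : seq 'I_m, `|word_mx A s| <= K * r ^+ size s.

Lemma growth_bound_le {R : realType} {m n : nat} (A : 'I_m -> 'M[R]_n) (r r' : R) :
  0 < r -> r <= r' -> growth_bound A r -> growth_bound A r'.
Proof.
move=> r0 rr' [K hK]; exists K => s; apply: le_trans (hK s) _.
have K0 : 0 <= K by have := hK [::]; rewrite expr0 mulr1; apply: le_trans.
by rewrite ler_wpM2l// lerXn2r// nnegrE ltW// (lt_le_trans r0).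
Qed.

(** The product bound for the maximum norm loses a factor [n] per letter, hence
    the sum of the [n * `|A i|] as growth rate. *)
Lemma growth_bound_some {R : realType} {m n : nat} (A : 'I_m -> 'M[R]_n) :
  exists2 a : R, 0 < a & growth_bound A a.
Proof.
pose a := \sum_i (n%:R * `|A i|) + 1.
have a_ge i : n%:R * `|A i| <= a.
  by rewrite /a (bigD1 i)//= -addrA lerDl addr_ge0// sumr_ge0.
have a0 : 0 < a by rewrite ltr_wpDl// sumr_ge0.
exists a => //; exists `|1%:M : 'M[R]_n|; elim=> [|i s IH]; first by rewrite mulr1.
rewrite word_mx_cons; apply: le_trans (mx_norm_mul _ _) _.
rewrite mulrAC [X in X <= _]mulrC exprSr [X in _ <= X]mulrA.
exact: ler_pM.
Qed.

(** Cut a word into blocks of length [k].  The factor [n] in the hypothesis pays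
    for the maximum norm being submultiplicative only up to [n]. *)
Lemma growth_bound_of_block {R : realType} {m n : nat} (A : 'I_m -> 'M[R]_n)
    (r : R) (k : nat) : 0 < r -> (0 < k)%N ->
  (forall s, size s = k -> n%:R * `|word_mx A s| <= r ^+ k) -> growth_bound A r.
Proof.
move=> r0 k0 hr; have [a a0 [b hb]] := growth_bound_some A.
have b0 : 0 <= b by have := hb [::]; rewrite expr0 mulr1; apply: le_trans.
have ar0 : 0 <= a / r by rewrite divr_ge0 ?ltW.
exists (b * (1 + a / r) ^+ k) => s.
have [N] := ubnP (size s); elim: N s => // N IH s sN.
have [sk|ks] := ltnP (size s) k.
  apply: le_trans (hb s) _; rewrite -mulrA ler_wpM2l//.
  have -> : a ^+ size s = (a / r) ^+ size s * r ^+ size s.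
    by rewrite expr_div_n divfK// expf_neq0// gt_eqF.
  apply: ler_wpM2r; first by rewrite exprn_ge0// ltW.
  apply: (@le_trans _ _ ((1 + a / r) ^+ size s)).
    by rewrite lerXn2r// ?nnegrE ?addr_ge0// lerDr.
  by rewrite ler_weXn2l ?lerDl// ltnW.
rewrite -[in X in X <= _](cat_take_drop k s) word_mx_cat.
apply: le_trans (mx_norm_mul _ _) _; rewrite mulrAC.
have sz : size (take k s) = k by rewrite size_take_min (minn_idPl ks).
have -> : size s = (k + size (drop k s))%N by rewrite size_drop subnKC.
rewrite exprD mulrCA; apply: ler_pM; rewrite ?mulr_ge0//; first exact: hr.
apply: IH; rewrite size_drop ltn_subLR//; apply: leq_trans sN _.
by rewrite -add1n leq_add2r.
Qed.

Lemma geometric_dominates {R : realType} (a b K : R) : 0 < a -> a < b ->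
  (\forall k \near \oo, K * a ^+ k <= b ^+ k)%classic.
Proof.
move=> a0 ab; have b0 := lt_trans a0 ab.
have ab0 : 0 <= a / b by rewrite divr_ge0// ltW.
have : `|a / b| < 1 by rewrite ger0_norm// ltr_pdivrMr// mul1r.
move=> /cvg_expr/cvgrPdist_lt h.
have K0 : 0 < 1 + `|K| by rewrite ltr_pwDl.
have := h (1 + `|K|)^-1; rewrite invr_gt0 => /(_ K0); apply: filterS => k.
rewrite sub0r normrN ger0_norm ?exprn_ge0// expr_div_n.
rewrite ltr_pdivrMr ?exprn_gt0// mulrC ltr_pdivlMr// => /ltW; apply: le_trans.
rewrite mulrC; apply: ler_wpM2l; first by rewrite exprn_ge0// ltW.
by rewrite (le_trans (ler_norm _))// lerDr.
Qed.

Lemma powR_rootK {R : realType} (a : R) (k : nat) :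
  (0 < k)%N -> 0 <= a -> (a `^ (k%:R^-1)) ^+ k = a.
Proof.
move=> k0 a0; rewrite -powR_mulrn ?powR_ge0// -powRrM mulVf ?powRr1//.
by rewrite pnatr_eq0 -lt0n.
Qed.

Lemma word_root_maxP {R : realType} {m n : nat} (A : 'I_m -> 'M[R]_n) (k : nat)
    (t : R) :
  (0 < k)%N -> 0 <= t ->
  reflect (forall s : seq 'I_m, size s = k -> `|word_mx A s| <= t ^+ k)
    (\big[Num.max/0]_(s : k.-tuple 'I_m) `| word_mx A s | `^ (k%:R^-1) <= t).
Proof.
move=> k0 t0.
have e (x : R) : 0 <= x -> (x `^ (k%:R^-1) <= t) = (x <= t ^+ k).
  by move=> x0; rewrite -[in RHS](powR_rootK x k k0 x0) ler_pXn2r// nnegrE powR_ge0.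
apply: (iffP idP) => [/bigmax_leP[_ h] s /eqP sk|h].
  by have := h (Tuple sk) isT; rewrite e.
by apply: bigmax_le => // s _; rewrite e// h ?size_tuple.
Qed.

(** The argument of Fekete's lemma, in the form: the joint spectral radius is the
    infimum of the admissible growth rates.  A growth rate bounds the [k]-th
    terms from above, a constant factor being negligible against a change of
    rate; conversely, if some large [k] had its term well below the infimum, then
    blocks of length [k] would yield a growth rate below the infimum.  This also
    shows that the limit exists. *)
Lemma jsrE {R : realType} {m n : nat} (A : 'I_m -> 'M[R]_n) :
  jsr A = inf [set r : R | 0 < r /\ growth_bound A r]%classic.
Proof.
set S := [set r : R | _]%classic; set L := inf S.
have S0 : (S !=set0)%classic by have [a] := growth_bound_some A; exists a.
have L0 : 0 <= L by apply: lb_le_inf => // r [/ltW].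
have Slb : has_lbound S by exists 0 => r [/ltW].
apply: cvg_lim => //; apply/cvgrPdist_le => e e0.
have [r [r0 [K hK]] rL] : exists2 r, S r & r < L + e.
  by apply: inf_lt => //; rewrite ltrDl.
have up := geometric_dominates r (L + e) K r0 rL.
have Le0 : 0 <= L + e by rewrite addr_ge0// ltW.
have lo : (\forall k \near \oo, (0 < k)%N -> L - e <=
    \big[Num.max/0]_(s : k.-tuple 'I_m) `| word_mx A s | `^ (k%:R^-1))%classic.
  have [Le|Le] := leP (L - e) 0.
    by near=> k => _; apply: le_trans Le _; apply: bigmax_ge_id.
  have Le2 : L - e < L - e / 2 by lra.
  have := geometric_dominates (L - e) (L - e / 2) n%:R Le Le2.
  apply: filterS => k hk k0; rewrite leNgt; apply/negP => /ltW.
  move=> /(word_root_maxP A k (L - e) k0 (ltW Le)) h.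
  have : S (L - e / 2).
    split; first exact: lt_trans Le2.
    apply: (@growth_bound_of_block _ _ _ _ _ k) => //.
      exact: lt_trans Le2.
    by move=> s /h hs; apply: le_trans hk; rewrite ler_wpM2l.
  by move=> /(ge_inf Slb); rewrite -/L; lra.
near=> k.
have k0 : (0 < k)%N by near: k; exists 1%N.
rewrite ler_distlC; apply/andP; split.
  by move: k0; near: k.
apply/word_root_maxP => // s sk.
have := hK s; rewrite sk => /le_trans; apply.
by near: k.
Unshelve. all: by end_near. Qed.

Lemma jsr_ge0 {R : realType} {m n : nat} (A : 'I_m -> 'M[R]_n) : 0 <= jsr A.
Proof.
rewrite jsrE; apply: lb_le_inf; last by move=> r [/ltW].
by have [a] := growth_bound_some A; exists a.
Qed.

Lemma jsr_le_growth {R : realType} {m n : nat} (A : 'I_m -> 'M[R]_n) (r : R) :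
  0 < r -> growth_bound A r -> jsr A <= r.
Proof. by move=> r0 h; rewrite jsrE; apply: ge_inf => //; exists 0 => ? [/ltW]. Qed.

Lemma growth_bound_gt_jsr {R : realType} {m n : nat} (A : 'I_m -> 'M[R]_n) (r : R) :
  jsr A < r -> growth_bound A r.
Proof.
rewrite jsrE => /inf_lt[|r' [r'0 h] /ltW r'r]; last exact: growth_bound_le h.
by have [a] := growth_bound_some A; exists a.
Qed.

(** * Graphs entered at every node by every letter *)

(** The property of De Bruijn graphs that gives both path-completeness and the
    maximum as a common Lyapunov function. *)
Definition fully_entered {m : nat} (G : lgraph m) : Prop :=
  forall (v : node G) (i : 'I_m), exists2 e : edge G, target e = v & label e = i.

(** A path reading the word is built backwards from its last letter. *)
Lemma fully_entered_path_complete {m : nat} (G : lgraph m) (v0 : node G) :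
  fully_entered G -> path_complete G.
Proof.
move=> enterG s _; elim: s => [|i s [p [dp ps]]]; first by exists [::].
case: p dp ps => [|e p] dp ps.
  by have [e _ ei] := enterG v0 i; exists [:: e]; rewrite -ps /= ei.
have [e' e't e'i] := enterG (source e) i.
by exists [:: e', e & p]; rewrite -ps /= e'i /dipath /= e't eqxx.
Qed.

Lemma quad_le_max_quad {R : realType} {n r : nat} (Q : 'I_r.+1 -> 'M[R]_n) j
    (x : 'cV[R]_n) : quad (Q j) x <= max_quad Q x.
Proof. exact: (le_bigmax _ (fun i => quad (Q i) x)). Qed.

(** For each letter, every form in the maximum at the image point is dominated,
    along an edge with this letter, by one of the forms at the original point. *)
Lemma lmi_max_quad_lyapunov {R : realType} {m n : nat} (G : lgraph m)
    (v0 : node G) (A : 'I_m -> 'M[R]_n) (g : R) :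
  fully_entered G -> lmi_feasible G A g ->
  has_max_quad_lyapunov (fun i => g *: A i).
Proof.
move=> enterG [P [pdP leP]].
have [r Er] : exists r, #|node G| = r.+1.
  by case: #|_| (fintype0 v0) => // r _; exists r.
pose Q j := P (enum_val (cast_ord (esym Er) j)).
have PQ v x : quad (P v) x <= max_quad Q x.
  have -> : P v = Q (cast_ord Er (enum_rank v)).
    by rewrite /Q cast_ordK enum_rankK.
  exact: quad_le_max_quad.
exists r, Q; split=> [j|i x]; first exact: pdP.
suff h v : quad (P v) ((g *: A i) *m x) <= max_quad Q x.
  by apply: bigmax_le => [|j _]; apply: h.
have [e <- <-] := enterG v i; apply: le_trans (PQ (source e) x).
have [_ /(_ x)] := leP e.
by rewrite -scaleN1r quadDl quadZl mulN1r subr_ge0 quad_congr_scale.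
Qed.

(** A common Lyapunov function comparable to the squared norm bounds all
    products of the scaled matrices. *)
Lemma jsr_le_of_lyapunov {R : realType} {m n : nat} (A : 'I_m -> 'M[R]_n) (g : R) :
  0 < g -> has_max_quad_lyapunov (fun i => g *: A i) -> jsr A <= g^-1.
Proof.
move=> g0 [r [Q [pdQ VQ]]].
set B := fun i => g *: A i in VQ.
have Vword s x : max_quad Q (word_mx B s *m x) <= max_quad Q x.
  elim: s x => [|i s IH] x; first by rewrite mul1mx.
  by rewrite word_mx_cons -mulmxA; apply: le_trans (IH _) (VQ _ _).
have V0 x : 0 <= max_quad Q x.
  exact: le_trans (posdef_quad_ge0 x (pdQ ord0)) (quad_le_max_quad _ _ _).
have [c c0 cQ] := posdef_coercive _ (pdQ ord0).
pose D := \sum_j max_quad Q (delta_mx j 0 : 'cV[R]_n).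
have Bs s : `|word_mx B s| <= Num.sqrt (c * D).
  apply: mx_norm_le => [|i j]; first exact: sqrtr_ge0.
  have D0 : 0 <= D by apply: sumr_ge0.
  have cD0 : 0 <= c * D by rewrite mulr_ge0// ltW.
  rewrite -sqrtr_sqr ler_sqrt//.
  have -> : word_mx B s i j = (word_mx B s *m delta_mx j 0 : 'cV[R]_n) i 0.
    by rewrite -colE mxE.
  apply: le_trans (cQ _ _) _; rewrite ler_pM2l//.
  apply: le_trans (quad_le_max_quad _ _ _) _; apply: le_trans (Vword _ _) _.
  by rewrite /D (bigD1 j)//= lerDl sumr_ge0.
apply: jsr_le_growth; first by rewrite invr_gt0.
exists (Num.sqrt (c * D)) => s; have := Bs s.
rewrite word_mxZ mx_normZ normrX gtr0_norm// mulrC -ler_pdivlMr ?exprn_gt0//.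
by rewrite exprVn.
Qed.

(** * The De Bruijn graph *)

(** The edge [(i, v)] stands for the word [i :: v] of length [k.+1]: it goes from
    the first [k] letters to the last [k] letters, and reads the letter that is
    dropped.  A node thus records the next [k] letters to be applied. *)
Definition debruijn_graph (m k : nat) : lgraph m :=
  @LGraph m (k.-tuple 'I_m : finType) ('I_m * k.-tuple 'I_m : finType)%type
    (fun e => belast_tuple e.1 e.2) snd fst.

Lemma debruijn_fully_entered (m k : nat) : fully_entered (debruijn_graph m k).
Proof. by move=> v i; exists (i, v). Qed.

(** Suppose that products of [k.+1] matrices contract [P].  At the node [v], take
    the sum of the values of [P] along the trajectory of [x] under the first
    [0, ..., k] letters of [v].  Passing the edge of the word [i :: v]
    shifts this sum by one step: the value at [x] leaves and the value at
    the image of [x] under the whole word enters, which is not larger. *)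
Lemma contraction_lmi_feasible {R : realType} {m n k : nat}
    (A : 'I_m -> 'M[R]_n) (g : R) (P : 'M[R]_n) : posdefmx P ->
  (forall s x, size s = k.+1 ->
     quad P (word_mx (fun i => g *: A i) s *m x) <= quad P x) ->
  lmi_feasible (debruijn_graph m k) A g.
Proof.
move=> pdP decP; have [sP pP] := pdP.
set B := fun i => g *: A i in decP.
pose W (s : seq 'I_m) j := word_mx B (take j s).
pose V (v : k.-tuple 'I_m) := \sum_(j < k.+1) (W v j)^T *m P *m W v j.
have qV v x : quad (V v) x = \sum_(j < k.+1) quad P (W v j *m x).
  by rewrite quad_suml; apply: eq_bigr => j _; rewrite quad_congr.
have sV v : (V v)^T = V v.
  rewrite /V linear_sum; apply: eq_bigr => j _ /=.
  by rewrite !trmx_mul trmxK sP mulmxA.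
exists V; split=> [v|[i v] /=].
  split=> // x x0; rewrite qV big_ord_recl /W take0 mul1mx.
  by rewrite ltr_pwDl ?pP// sumr_ge0// => j _; apply: posdef_quad_ge0.
split=> [|x].
  by rewrite linearB linearZ /= !trmx_mul trmxK !sV mulmxA.
rewrite -scaleN1r quadDl quadZl mulN1r subr_ge0 quad_congr_scale -/(B i) !qV.
have -> : \sum_(j < k.+1) quad P (W (belast i v) j *m x) =
          \sum_(j < k.+1) quad P (W (i :: v) j *m x).
  apply: eq_bigr => j _; rewrite /W lastI -cats1 takel_cat//.
  by rewrite size_belast size_tuple -ltnS.
have -> : \sum_(j < k.+1) quad P (W v j *m (B i *m x)) =
          \sum_(j < k.+1) quad P (W (i :: v) j.+1 *m x).
  by apply: eq_bigr => j _; rewrite /W /= word_mx_cons mulmxA.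
rewrite [X in _ <= X]big_ord_recl [X in X <= _]big_ord_recr /= addrC lerD2r.
rewrite /W take0 mul1mx; apply: decP.
by rewrite size_take /= size_tuple ltnn.
Qed.

(** * The lower bound on the joint spectral radius *)

(** Apply the ellipsoid lemma to the rows of all products of [r^-1 *: A].  This
    family is bounded, contains the coordinate functionals (empty word), and is
    stable under composition with a product, so a product does not increase
    the seminorm that it defines; [P] is this seminorm squared up to [c]. *)
Lemma common_quadratic_of_growth {R : realType} {m n : nat}
    (A : 'I_m -> 'M[R]_n) (r c : R) :
  (0 < n)%N -> 0 < r -> growth_bound A r -> n%:R < c ->
  exists2 P : 'M[R]_n, posdefmx P & forall s (x : 'cV[R]_n),
    quad P (word_mx A s *m x) <= c * r ^+ (2 * size s) * quad P x.
Proof.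
move=> n0 r0 [K hK] nc.
pose B i := r^-1 *: A i.
have BE s : word_mx B s = r ^- size s *: word_mx A s by rewrite word_mxZ exprVn.
pose F := [set row i (word_mx B s) | i in setT & s in setT]%classic.
have [|i|P pdP [domP Pdom]] := @approx_lowner_ellipsoid R n F K c n0 _ _ nc.
- move=> _ i [j _ [s _ <-]]; rewrite mxE; apply: le_trans (mx_entry_le_norm _ _ _) _.
  rewrite BE mx_normZ gtr0_norm ?invr_gt0 ?exprn_gt0//.
  by rewrite mulrC ler_pdivrMr ?exprn_gt0.
- by exists i => //; exists [::]; rewrite // row1.
exists P => // s x.
have -> : word_mx A s *m x = r ^+ size s *: (word_mx B s *m x).
  by rewrite BE -scalemxAl scalerA mulfV ?scale1r// expf_neq0// gt_eqF.
rewrite quad_scale -exprM mulnC mulrAC mulrC ler_pM2r ?exprn_gt0//.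
apply: domP => _ [i _ [t _ <-]].
rewrite mulmxA -row_mul -word_mx_cat; apply: Pdom.
by exists i => //; exists (s ++ t).
Qed.

Lemma debruijn_feasible_above_jsr {R : realType} {m n k : nat}
    (A : 'I_m -> 'M[R]_n) (r c : R) :
  (0 < n)%N -> jsr A < r -> n%:R < c ->
  let b := c `^ ((2 * k.+1)%:R^-1) * r in
  0 < b /\ lmi_feasible (debruijn_graph m k) A b^-1.
Proof.
move=> n0 Ar nc b.
have r0 : 0 < r := le_lt_trans (jsr_ge0 A) Ar.
have c0 : 0 < c by apply: le_lt_trans nc.
have b0 : 0 < b by rewrite mulr_gt0// powR_gt0.
split=> //.
have [P pdP hP] :=
  common_quadratic_of_growth A r c n0 r0 (growth_bound_gt_jsr _ _ Ar) nc.
apply: (contraction_lmi_feasible A b^-1 P pdP) => s x sk.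
rewrite word_mxZ -scalemxAl quad_scale -exprM mulnC sk.
apply: le_trans (ler_wpM2l _ (hP s x)) _; first by rewrite exprn_ge0// invr_ge0 ltW.
rewrite sk mulrA exprVn exprMn powR_rootK ?(ltW c0)// mulVf ?mul1r//.
by rewrite mulf_neq0 ?expf_neq0 ?gt_eqF.
Qed.

Lemma rho_hat_le {R : realType} {m n : nat} (G : lgraph m) (A : 'I_m -> 'M[R]_n)
    (g : R) : 0 < g -> lmi_feasible G A g -> rho_hat G A <= g^-1.
Proof.
move=> g0 fg; apply: ge_inf; last by exists g.
by exists 0 => _ [h [h0 _] <-]; rewrite invr_ge0 ltW.
Qed.

(** Here both approximations are removed: first [c] tends to [n], on powers
    of exponent [2 * k.+1] so as not to need continuity of the root, then [r] tends to the joint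
    spectral radius. *)
Lemma rho_hat_debruijn_le {R : realType} {m n k : nat} (A : 'I_m -> 'M[R]_n) :
  (0 < n)%N ->
  rho_hat (debruijn_graph m k) A <= n%:R `^ ((2 * k.+1)%:R^-1) * jsr A.
Proof.
move=> n0; set L := (2 * k.+1)%N; set h := rho_hat _ _.
have hle c r : n%:R < c -> jsr A < r -> h <= c `^ (L%:R^-1) * r.
  move=> nc Ar.
  have [b0 fb] := @debruijn_feasible_above_jsr R m n k A r c n0 Ar nc.
  by rewrite -[X in _ <= X]invrK; apply: rho_hat_le; rewrite ?invr_gt0.
have n0R : 0 < n%:R :> R by rewrite ltr0n.
have np0 : 0 < n%:R `^ (L%:R^-1) :> R by rewrite powR_gt0.
have hle' r : jsr A < r -> h <= n%:R `^ (L%:R^-1) * r.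
  move=> Ar; have r0 : 0 < r := le_lt_trans (jsr_ge0 A) Ar.
  have nr0 : 0 <= n%:R `^ (L%:R^-1) * r by rewrite ltW// mulr_gt0.
  have [h0|/ltW h0] := leP h 0; first exact: le_trans h0 nr0.
  rewrite -(@ler_pXn2r _ L)//.
  rewrite exprMn powR_rootK//; apply/ler_addgt0Pr => e e0.
  have rL : 0 < r ^+ L by rewrite exprn_gt0.
  have nc : n%:R < n%:R + e / r ^+ L by rewrite ltrDl divr_gt0.
  have c0 : 0 <= n%:R + e / r ^+ L by rewrite ltW// (lt_trans _ nc).
  have cr0 : 0 <= (n%:R + e / r ^+ L) `^ (L%:R^-1) * r.
    by rewrite mulr_ge0 ?powR_ge0// ltW.
  have := hle _ _ nc Ar.
  rewrite -(@ler_pXn2r _ L)//.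
  by rewrite exprMn powR_rootK// mulrDl divfK// gt_eqF.
rewrite mulrC -ler_pdivrMr//; apply/ler_addgt0Pr => e e0.
by rewrite ler_pdivrMr// mulrC; apply: hle'; rewrite ltrDl.
Qed.

Theorem theorem5p17 (R : realType) (m l : nat) (hm : (0 < m)%N) (hl : (0 < l)%N) :
  exists G : lgraph m,
    [/\ path_complete G,
        #|node G| = (m ^ (l - 1))%N,
        #|edge G| = (m ^ l)%N &
        forall (n : nat) (hn : (0 < n)%N) (A : 'I_m -> 'M[R]_n),
          (forall gamma : R, 0 < gamma -> lmi_feasible G A gamma ->
             has_max_quad_lyapunov (fun i => gamma *: A i)) /\
          ((n%:R `^ ((2 * l)%:R^-1))^-1 * rho_hat G A <= jsr A /\
           jsr A <= rho_hat G A)].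
Proof.
case: l hl => // k _.
pose v0 : node (debruijn_graph m k) := [tuple of nseq k (Ordinal hm)].
have enterG := debruijn_fully_entered m k.
exists (debruijn_graph m k); split.
- exact: (fully_entered_path_complete _ v0 enterG).
- by rewrite card_tuple card_ord subn1.
- by rewrite card_prod card_tuple card_ord expnS.
move=> n hn A.
have lyap g : lmi_feasible (debruijn_graph m k) A g ->
    has_max_quad_lyapunov (fun i => g *: A i).
  exact: (lmi_max_quad_lyapunov _ v0 A g enterG).
split=> [g _|]; first exact: lyap.
have np0 : 0 < n%:R `^ ((2 * k.+1)%:R^-1) :> R by rewrite powR_gt0// ltr0n.
split; first by rewrite mulrC ler_pdivrMr// mulrC; apply: rho_hat_debruijn_le.
apply: lb_le_inf => [|_ [g [g0 /lyap fg] <-]]; last exact: jsr_le_of_lyapunov.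
have [||b0 fb] := @debruijn_feasible_above_jsr R m n k A (jsr A + 1) (n%:R + 1) hn.
- by rewrite ltrDl.
- by rewrite ltrDl.
set b := _ * _ in b0 fb.
by exists b^-1^-1; exists b^-1 => //; split=> //; rewrite invr_gt0.
Qed.
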